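(* Fix an integer $s \ge 4$. Then $r(P_s, t) = \Theta(t^2)$ as $t \to \infty$; that is, there are constants $c_s, C_s > 0$ (depending only on $s$) such that $c_s t^2 \le r(P_s,t) \le C_s t^2$ for all sufficiently large $t$.
   Context: $P_s$ denotes the $3$-uniform tight path: the $3$-uniform hypergraph with vertex set $\{1,\dots,s+2\}$ and edge set $\{\{i,i+1,i+2\} : 1 \le i \le s\}$. For a $3$-uniform hypergraph $F$, the Ramsey number $r(F,t)$ is the smallest $n$ such that every red-blue coloring of the edges of the complete $3$-uniform hypergraph $K_n^{(3)}$ contains a red copy of $F$ or a blue copy of $K_t^{(3)}$. *)

(* Defs.v *)
From mathcomp Require Import all_boot.

Set Implicit Arguments.
Unset Strict Implicit.
Unset Printing Implicit Defensive.

Record hypergraph3 := Hypergraph3 {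
  hvertex : finType;
  hedges : {set {set hvertex}};
  hedges_card3 : forall e, e \in hedges -> #|e| = 3
}.

(* G contains a copy of F, as a not necessarily induced subhypergraph. *)
Definition contains_copy (G F : hypergraph3) : Prop :=
  exists f : hvertex F -> hvertex G,
    injective f /\ forall e, e \in hedges F -> f @: e \in hedges G.

Definition complete_edges (n : nat) : {set {set 'I_n}} :=
  [set e : {set 'I_n} | #|e| == 3].

Lemma complete_edges_card3 (n : nat) (e : {set 'I_n}) :
  e \in complete_edges n -> #|e| = 3.
Proof. by rewrite inE => /eqP. Qed.

Definition complete3 (n : nat) : hypergraph3 :=
  Hypergraph3 (@complete_edges_card3 n).

(* The vertex x : 'I_s.+2 stands for x + 1 in {1, ..., s + 2}; all the
   arguments of inord below are less than s + 2. *)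
Definition tight_path_edges (s : nat) : {set {set 'I_s.+2}} :=
  [set [set inord i; inord i.+1; inord i.+2] | i : 'I_s].

Lemma tight_path_edges_card3 (s : nat) (e : {set 'I_s.+2}) :
  e \in tight_path_edges s -> #|e| = 3.
Proof.
case/imsetP=> i _ ->; have lti := ltn_ord i.
have neq (a b : nat) : a < b -> b < s.+2 -> (inord a == inord b :> 'I_s.+2) = false.
  move=> ltab ltb; apply/negbTE; rewrite -val_eqE /= !inordK ?neq_ltn ?ltab //.
  exact: ltn_trans ltab ltb.
rewrite setUC cardsU1 cards2 !inE (eq_sym (inord i.+2)) (eq_sym (inord i.+2)).
by rewrite !neq // !ltnS // ltnW.
Qed.

Definition tight_path (s : nat) : hypergraph3 :=
  Hypergraph3 (@tight_path_edges_card3 s).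

Definition red : bool := true.
Definition blue : bool := false.

(* The subhypergraph of K_n^(3) formed by the edges of colour b; the values of
   the colouring c on sets that are not triples play no role. *)
Definition colour_class_edges (n : nat) (c : {set 'I_n} -> bool) (b : bool) :
  {set {set 'I_n}} := [set e in hedges (complete3 n) | c e == b].

Lemma colour_class_edges_card3 (n : nat) (c : {set 'I_n} -> bool) (b : bool)
  (e : {set 'I_n}) : e \in colour_class_edges c b -> #|e| = 3.
Proof. by rewrite inE => /andP[/hedges_card3]. Qed.

Definition colour_class (n : nat) (c : {set 'I_n} -> bool) (b : bool) :
  hypergraph3 := Hypergraph3 (@colour_class_edges_card3 n c b).

Definition ramsey_arrow (n : nat) (F : hypergraph3) (t : nat) : Prop :=
  forall c : {set 'I_n} -> bool,
    contains_copy (colour_class c red) F \/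
    contains_copy (colour_class c blue) (complete3 t).

(* r(F, t) = n. Stated as a relation, so that asserting it for some n includes
   the existence of the Ramsey number. *)
Definition is_ramsey_number (F : hypergraph3) (t n : nat) : Prop :=
  ramsey_arrow n F t /\ forall m : nat, ramsey_arrow m F t -> n <= m.

(* Main.v *)
Require Import Defs.
From mathcomp Require Import all_boot all_order all_algebra.
From mathcomp Require Import boolp reals.
From mathcomp Require Import zify.
Import Order.TTheory GRing.Theory Num.Theory.

Set Implicit Arguments.
Unset Strict Implicit.
Unset Printing Implicit Defensive.

(* Lower bound: on the m x m grid, colour red the corners {(x, y), (x, y'), (x', y)}
   with x < x' and y < y'.  Any two points of a corner have its apex (x, y) as
   coordinatewise minimum, so consecutive edges of a red tight path share their
   apex; four edges are impossible, as the first and the fourth are disjoint.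
   In a set without red corners every point is topmost in its column or
   rightmost in its row, so the set has at most 2m points.

   Upper bound: while some pair lies in between 1 and s + 2 red edges, delete
   these edges.  If more than (s + 2) n^2 edges were present, something remains,
   and in it a tight path can be extended greedily.  So a red graph without P_s
   has at most (s + 2) n^2 edges.  Averaging gives 2t vertices that span at most
   t red edges when n = 32 (s + 2) t^2; removing a vertex from each of these
   edges leaves a blue clique on t vertices. *)

(** * Greedy tight paths in hypergraphs with large codegrees *)

Section Codegree.

Variable T : finType.
Implicit Types (H : {set {set T}}) (W : {set T}).

Definition conbr H (x y : T) : {set T} := [set z | [set x; y; z] \in H].

(** The pairs are ordered, whence the bound [#|T| ^ 2] on their number. *)
Definition shadow H : {set T * T} := [set p | conbr H p.1 p.2 != set0].

(** Deleting the at most [D] edges through a pair of small nonzero codegree takes that pair out of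
    the shadow. Both sides of the hypothesis drop, the left one by at least [D], so it is preserved
    and the process stops at a nonempty hypergraph. *)
Lemma exists_large_codegree D H : D * #|shadow H| < #|H| ->
  exists H', [/\ H' \subset H, H' != set0 &
    forall x y, conbr H' x y != set0 -> D < #|conbr H' x y|].
Proof.
elim: {H}_.+1 {-2}H (ltnSn #|H|) => // N IH H leHN ltDH.
have [/existsP[[x y] /= /andP[nz leD]]|large] :=
  boolP [exists p : T * T, (conbr H p.1 p.2 != set0) && (#|conbr H p.1 p.2| <= D)];
  last first.
  exists H; split=> // [|x y nz].
    by rewrite -card_gt0 (leq_ltn_trans _ ltDH).
  rewrite ltnNge; apply: contra large => leD.
  by apply/existsP; exists (x, y); rewrite nz.
pose E := [set [set x; y; z] | z in conbr H x y].
have sEH : E \subset H by apply/subsetP=> e /imsetP[z]; rewrite inE => ? ->.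
have leE : #|E| <= D by apply: leq_trans (leq_imset_card _ _) leD.
have E_gt0 : 0 < #|E|.
  by have /set0Pn[z zN] := nz; apply/card_gt0P; exists [set x; y; z]; apply: imset_f.
have cardH : #|H :\: E| + #|E| = #|H|.
  by have := cardsID E H; rewrite (setIidPr sEH) => <-; rewrite addnC.
have ltS : #|shadow (H :\: E)| < #|shadow H|.
  apply/proper_card/properP; split.
    apply/subsetP=> -[a b]; rewrite !inE /= => /set0Pn[z].
    by rewrite !inE => /andP[_ zH]; apply/set0Pn; exists z; rewrite inE.
  exists (x, y); rewrite !inE //= negbK; apply/eqP/setP=> z.
  rewrite !inE; apply/negP=> /andP[/negP nE zH]; apply: nE.
  by apply: imset_f; rewrite inE.
case: (IH (H :\: E)) => [||H' [sH' nzH' large]].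
- by lia.
- by nia.
by exists H'; split=> //; apply: subset_trans sH' (subsetDl _ _).
Qed.

Lemma tight_walk_extension H s x y : conbr H x y != set0 -> x != y ->
    (forall x y, conbr H x y != set0 -> s.+2 < #|conbr H x y|) ->
  exists g : nat -> T, {in [pred i | i < s.+2] &, injective g} /\
    forall i, i < s -> [set g i; g i.+1; g i.+2] \in H.
Proof.
move=> nzxy nexy large.
suff [g [injg gH _]] : exists g : nat -> T,
    [/\ {in [pred i | i < s.+2] &, injective g},
        forall i, i < s -> [set g i; g i.+1; g i.+2] \in H &
        conbr H (g s) (g s.+1) != set0] by exists g.
(* The length of the path varies in the induction, while [large] keeps the original [s]. The
   invariant is that the last pair of the path still lies in an edge. *)
elim: {-2}s (leqnn s) => [_|j IH ltjs].
  exists (fun i => if i == 0 then x else y); split=> //.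
  move=> [|[|i]] [|[|k]] //=; rewrite !inE => // _ _ exy.
    by rewrite exy eqxx in nexy.
  by rewrite exy eqxx in nexy.
have [g [injg gH nz]] := IH (ltnW ltjs).
(* The last pair has more than [s.+2] continuations, and only [j.+2] vertices are taken. *)
have /subsetPn[z zN zg] :
    ~~ (conbr H (g j) (g j.+1) \subset [set g (i : 'I_j.+2) | i : 'I_j.+2]).
  apply/negP=> /subset_leq_card /leq_trans/(_ (leq_imset_card _ _)).
  by rewrite card_ord leqNgt (leq_ltn_trans _ (large _ _ nz)) // !ltnS ltnW.
have zg' i : i < j.+2 -> z != g i.
  by move=> lti; apply: contra zg => /eqP->; apply/imsetP; exists (Ordinal lti).
have zH : [set g j; g j.+1; z] \in H by rewrite inE in zN.
exists (fun i => if i == j.+2 then z else g i); split.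
- move=> a b; rewrite !inE /= => lta ltb.
  case: eqP => [->|nea]; case: eqP => [->|neb] // egab.
  + by have /eqP[] : z != g b by apply: zg'; lia.
  + by have /eqP[] : z != g a by apply: zg'; lia.
  + by apply: injg => //; rewrite inE; lia.
- move=> i lti; have -> : (i == j.+2) = false by lia.
  have -> : (i.+1 == j.+2) = false by lia.
  case: eqP => [[->]|nei] //.
  by apply: gH; lia.
- have -> : (j.+1 == j.+2) = false by lia.
  rewrite eqxx; apply/set0Pn; exists (g j); rewrite inE.
  by rewrite setUC setUA.
Qed.

Lemma card_shadow_le H : #|shadow H| <= #|T| ^ 2.
Proof. by apply: leq_trans (max_card _) _; rewrite card_prod mulnn. Qed.

Lemma card3_conbr H e : (forall e, e \in H -> #|e| = 3) -> e \in H ->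
  exists x y, x != y /\ conbr H x y != set0.
Proof.
move=> H3 eH; have e3 := H3 e eH.
have /card_gt0P[x xe] : 0 < #|e| by rewrite e3.
have := cardsD1 x e; rewrite xe e3 => -[/esym/eqP/cards2P[y [z [_ eyz]]]].
have : y \in e :\ x by rewrite eyz !inE eqxx.
rewrite !inE => /andP[nyx _]; exists x, y; split; first by rewrite eq_sym.
by apply/set0Pn; exists z; rewrite inE -setUA -eyz setD1K.
Qed.

Lemma tight_path_free_bound H s : (forall e, e \in H -> #|e| = 3) ->
    s.+2 * #|T| ^ 2 < #|H| ->
  exists g : nat -> T, {in [pred i | i < s.+2] &, injective g} /\
    forall i, i < s -> [set g i; g i.+1; g i.+2] \in H.
Proof.
move=> H3 ltH.
have [|H' [sH' /set0Pn[e eH'] large]] := @exists_large_codegree s.+2 H.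
  by apply: leq_ltn_trans ltH; rewrite leq_mul2l card_shadow_le orbT.
have [|x [y [nxy nz]]] := @card3_conbr H' e _ eH'.
  by move=> e' /(subsetP sH'); apply: H3.
have [g [injg gH]] := tight_walk_extension nz nxy large.
by exists g; split=> // i /gH; apply: (subsetP sH').
Qed.

(** * Sparse vertex subsets and independent sets *)

Definition edges_in H W : {set {set T}} := [set e in H | e \subset W].

(** Double counting: an edge inside [W] survives the removal of exactly the [#|W| - 3] vertices
    outside it. *)
Lemma sum_edges_in_D1 H W : (forall e, e \in H -> #|e| = 3) ->
  \sum_(v in W) #|edges_in H (W :\ v)| = (#|W| - 3) * #|edges_in H W|.
Proof.
move=> H3.
transitivity (\sum_(v in W) \sum_(e in edges_in H W) (v \notin e : nat)).
  apply: eq_bigr => v vW; rewrite -big_mkcondr /= sum1dep_card.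
  apply: eq_card => e; rewrite !inE subsetD1.
  by rewrite andbA.
rewrite exchange_big /= mulnC -sum_nat_const; apply: eq_bigr => e.
rewrite inE => /andP[eH eW].
rewrite -big_mkcondr /= sum1dep_card -(H3 e eH).
have := cardsID e W; rewrite (setIidPr eW) => <-; rewrite addKn.
by apply: eq_card => v; rewrite !inE andbC.
Qed.

Lemma edges_in_D1_average H W : (forall e, e \in H -> #|e| = 3) -> 0 < #|W| ->
  exists2 v, v \in W & #|W| * #|edges_in H (W :\ v)| <= (#|W| - 3) * #|edges_in H W|.
Proof.
move=> H3 /card_gt0P[v0 v0W].
case: (arg_minnP (fun v => #|edges_in H (W :\ v)|) v0W) => v vW minv.
exists v => //; rewrite -sum_edges_in_D1 // -sum_nat_const.
by apply: leq_sum => i iW; apply: minv.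
Qed.

(** Removing a vertex that leaves the fewest edges never raises the density, here the number of
    edges over [#|W| ^_ 3]. The induction descends from the full vertex set, and the inequality is
    stated free of division. *)
Lemma exists_sparse_subset H k : (forall e, e \in H -> #|e| = 3) -> k <= #|T| ->
  exists2 W : {set T}, #|W| = k & #|edges_in H W| * #|T| ^_ 3 <= #|H| * k ^_ 3.
Proof.
move=> H3; move: {2}(#|T| - k) (erefl (#|T| - k)) => d.
elim: d k => [|d IH] k ed lek.
  have <- : #|T| = k by lia.
  exists setT; first exact: cardsT.
  rewrite leq_mul2r; apply/orP; right; apply: subset_leq_card.
  by apply/subsetP=> e; rewrite inE => /andP[].
have [||W cW eW] := IH k.+1; [lia|lia|].
have [|v vW] := @edges_in_D1_average H W H3; first by rewrite cW.
rewrite cW => le1; exists (W :\ v).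
  by have := cardsD1 v W; rewrite vW cW; lia.
rewrite -(@leq_pmul2l k.+1) // mulnA.
apply: leq_trans (_ : (k.+1 - 3) * #|edges_in H W| * #|T| ^_ 3 <= _).
  by rewrite leq_mul2r le1 orbT.
have ff : (k.+1 - 3) * k.+1 ^_ 3 = k.+1 * k ^_ 3.
  by rewrite ffactSS [in RHS]ffactnSr mulnCA; congr (_ * _); rewrite mulnC.
by rewrite -mulnA [X in _ <= X]mulnCA -ff [X in _ <= X]mulnCA leq_mul2l eW orbT.
Qed.

(** Removing a vertex of a remaining edge costs one vertex and destroys at least one edge, so the
    hypothesis persists. *)
Lemma exists_independent H W t : (forall e, e \in H -> #|e| = 3) ->
    t + #|edges_in H W| <= #|W| ->
  exists2 I : {set T}, t <= #|I| & edges_in H I = set0.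
Proof.
move=> H3; elim: {W}_.+1 {-2}W (ltnSn #|edges_in H W|) => // N IH W ltN letW.
have [e0|/set0Pn[e]] := eqVneq (edges_in H W) set0.
  by exists W => //; apply: leq_trans letW; rewrite leq_addr.
move=> eW; have := eW; rewrite inE => /andP[eH seW].
have /card_gt0P[v ve] : 0 < #|e| by rewrite H3.
have lt1 : #|edges_in H (W :\ v)| < #|edges_in H W|.
  apply/proper_card/properP; split.
    by apply/subsetP=> f; rewrite !inE subsetD1 => /and3P[-> ->].
  by exists e => //; rewrite inE subsetD1 ve !andbF.
have cW := cardsD1 v W; rewrite (subsetP seW) // in cW.
by apply: (IH (W :\ v)); lia.
Qed.

End Codegree.

(** * The quadratic upper bound *)

(** The constant is 32 = 4 * 8: a factor 4 from [n ^ 3 <= 4 * n ^_ 3], valid for [n >= 4], and 8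
    from [(2 * t) ^ 3]. Then [e * n ^ 3] is at most [n ^ 2 * (t * n)]. *)
Lemma sparse_arith s t n E e : 0 < t -> n = 32 * s.+2 * t ^ 2 ->
  E <= s.+2 * n ^ 2 -> e * n ^_ 3 <= E * (2 * t) ^_ 3 -> e <= t.
Proof.
move=> t_gt0 nE leE lee.
have n4 : 4 <= n by nia.
have lef : (2 * t) ^_ 3 <= (2 * t) ^ 3.
  by rewrite !ffactnS ffactn0 !expnS expn0 !leq_mul //; lia.
have gef : n ^ 3 <= 4 * n ^_ 3.
  rewrite !ffactnS ffactn0 muln1.
  have -> : n ^ 3 = n * (n * n) by rewrite !expnS muln1.
  have : n * n <= 4 * (n.-1 * n.-2) by nia.
  nia.
have : e * n ^ 3 <= 4 * (s.+2 * n ^ 2 * (2 * t) ^ 3).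
  apply: leq_trans (_ : 4 * (e * n ^_ 3) <= _).
    by rewrite [X in _ <= X]mulnCA leq_mul2l gef orbT.
  rewrite leq_mul2l /=; apply: leq_trans lee _; exact: leq_mul.
have -> : n ^ 3 = n * n ^ 2 by rewrite expnS.
have -> : 4 * (s.+2 * n ^ 2 * (2 * t) ^ 3) = n ^ 2 * (t * n).
  by rewrite [in t * n]nE !expnS expn0; nia.
rewrite mulnA [e * n * _]mulnC leq_pmul2l ?expn_gt0; last by lia.
by rewrite leq_pmul2r //; lia.
Qed.

Lemma contains_tight_path n (c : {set 'I_n} -> bool) s (g : nat -> 'I_n) :
    {in [pred i | i < s.+2] &, injective g} ->
    (forall i, i < s -> [set g i; g i.+1; g i.+2] \in colour_class_edges c red) ->
  contains_copy (colour_class c red) (tight_path s).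
Proof.
move=> injg gH; exists (fun i : 'I_s.+2 => g i); split.
  by move=> i j /injg ij; apply/val_inj/ij; rewrite inE ltn_ord.
move=> e /imsetP[i _ ->] /=; have lti := ltn_ord i.
by rewrite !imsetU !imset_set1 /= !inordK; [apply: gH|lia..].
Qed.

Lemma ramsey_arrow_quadratic s t : 0 < t ->
  ramsey_arrow (32 * s.+2 * t ^ 2) (tight_path s) t.
Proof.
move=> t_gt0 c; set n := 32 * _ * _ in c *.
pose H := colour_class_edges c red.
have H3 e : e \in H -> #|e| = 3 by apply: colour_class_edges_card3.
have [leH|ltH] := leqP #|H| (s.+2 * #|'I_n| ^ 2); last first.
  have [g [injg gH]] := tight_path_free_bound H3 ltH.
  by left; apply: contains_tight_path injg gH.
right; rewrite card_ord in leH.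
have [|W cW eW] := @exists_sparse_subset _ H (2 * t) H3.
  by rewrite card_ord /n; nia.
rewrite card_ord in eW.
have leet := sparse_arith t_gt0 (erefl n) leH eW.
have [|I leI HI] := @exists_independent _ H W t H3.
  by rewrite cW; lia.
exists (fun i : 'I_t => enum_val (widen_ord leI i)); split.
  by move=> i j /enum_val_inj [] /val_inj.
move=> e; rewrite !inE => e3; rewrite card_imset ?e3 /=; last first.
  by move=> i j /enum_val_inj [] /val_inj.
rewrite eqbF_neg; apply/negP=> ce.
suff : (fun i : 'I_t => enum_val (widen_ord leI i)) @: e \in edges_in H I.
  by rewrite HI inE.
rewrite !inE ce card_imset ?e3 /=; last first.
  by move=> i j /enum_val_inj [] /val_inj.
by apply/subsetP=> _ /imsetP[i _ ->]; apply: enum_valP.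
Qed.

(** * Corners in the grid *)

Section Grid.

Variables (V : finType) (u v : V -> nat).
Hypothesis uv_inj : forall a b, u a = u b -> v a = v b -> a = b.

(** The point [a] is the apex, [b] lies above it in its column [u], and [c] to its right in its row
    [v]. *)
Definition corner (a b c : V) :=
  [&& u a == u b, v a < v b, v a == v c & u a < u c].

Definition corner_edge (e : {set V}) :=
  [exists a, exists b, exists c, corner a b c && (e == [set a; b; c])].

Lemma corner_pair_min a b c p q : corner a b c -> p != q ->
    p \in [set a; b; c] -> q \in [set a; b; c] ->
  minn (u p) (u q) = u a /\ minn (v p) (v q) = v a.
Proof.
move=> /and4P[/eqP uab vab /eqP vac uac] npq; rewrite !inE -!orbA.
by case/or3P=> /eqP ep; case/or3P=> /eqP eq; subst p q; rewrite ?eqxx in npq;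
  split; lia.
Qed.

Lemma corner_edge_tight_path_free (x : nat -> V) :
    {in [pred i | i < 6] &, injective x} ->
  ~ (forall i, i < 4 -> corner_edge [set x i; x i.+1; x i.+2]).
Proof.
move=> injx xe.
have apexP i : i < 4 -> exists2 a, a \in [set x i; x i.+1; x i.+2] &
    forall p q, p != q -> p \in [set x i; x i.+1; x i.+2] ->
      q \in [set x i; x i.+1; x i.+2] ->
      minn (u p) (u q) = u a /\ minn (v p) (v q) = v a.
  move=> /xe /existsP[a /existsP[b /existsP[c /andP[abc /eqP->]]]].
  by exists a; [rewrite !inE eqxx | move=> p q; apply: corner_pair_min].
have nx i j : i < 6 -> j < 6 -> i != j -> x i != x j.
  by move=> lti ltj; apply: contra => /eqP/injx->.
(* Consecutive edges share the pair [x i.+1], [x i.+2], which determines the apex. *)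
have step i a b : i < 3 ->
    (forall p q, p != q -> p \in [set x i; x i.+1; x i.+2] ->
      q \in [set x i; x i.+1; x i.+2] ->
      minn (u p) (u q) = u a /\ minn (v p) (v q) = v a) ->
    (forall p q, p != q -> p \in [set x i.+1; x i.+2; x i.+3] ->
      q \in [set x i.+1; x i.+2; x i.+3] ->
      minn (u p) (u q) = u b /\ minn (v p) (v q) = v b) -> a = b.
  move=> lti aP bP.
  have nxi : x i.+1 != x i.+2 by apply: nx; lia.
  have [||ua va] := aP _ _ nxi; rewrite ?inE ?eqxx ?orbT //.
  have [||ub vb] := bP _ _ nxi; rewrite ?inE ?eqxx ?orbT //.
  by apply: uv_inj; [rewrite -ua -ub | rewrite -va -vb].
have [a0 a0e a0P] := apexP 0 isT; have [a1 _ a1P] := apexP 1 isT.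
have [a2 _ a2P] := apexP 2 isT; have [a3 a3e a3P] := apexP 3 isT.
have e03 : a0 = a3.
  by rewrite (step 0 _ _ isT a0P a1P) (step 1 _ _ isT a1P a2P) (step 2 _ _ isT a2P a3P).
move: a0e a3e; rewrite -e03 !inE -!orbA.
by case/or3P=> /eqP-> /or3P[] /eqP/injx; rewrite !inE => /(_ isT isT).
Qed.

Lemma card_corner_free m (S : {set V}) :
    (forall a, u a < m) -> (forall a, v a < m) ->
    (forall a b c, a \in S -> b \in S -> c \in S -> ~~ corner a b c) ->
  #|S| <= 2 * m.
Proof.
move=> ltu ltv free.
have inj_bound (w : V -> nat) (A : {set V}) : (forall a, w a < m) ->
    {in A &, injective w} -> #|A| <= m.
  move=> ltw injw; rewrite -[X in _ <= X]card_ord.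
  rewrite -(@card_in_imset _ _ (fun a => Ordinal (ltw a))) ?max_card //.
  by move=> a b aA bA [] /injw; apply.
(* The points topmost in their column: [u] is injective on [A]. Off [A], [v] is injective. *)
pose A := [set a in S | [forall b in S, (u a == u b) ==> (v b <= v a)]].
have leA : #|A| <= m.
  apply: (inj_bound u) => // a b; rewrite !inE.
  move=> /andP[aS /forall_inP aP] /andP[bS /forall_inP bP] eab.
  apply: uv_inj => //; have := aP b bS; have := bP a aS.
  by rewrite eab eqxx /=; lia.
have leB : #|S :\: A| <= m.
  apply: (inj_bound v) => // a b; rewrite !inE.
  move=> /andP[naA aS] /andP[nbA bS] eab; apply: uv_inj => //.
  (* A point [x] with some [z] above it has no [y] to its right, or [x] would be the apex of a
     corner. *)
  have top x y : x \in S -> x \notin A -> y \in S -> v x = v y -> u y <= u x.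
    rewrite inE => xS; rewrite xS /= => /forall_inPn[z zS].
    rewrite negb_imply -ltnNge => /andP[/eqP uxz vxz] yS vxy.
    rewrite leqNgt; apply/negP=> ltu'.
    by have /negP[] := free x z y xS zS yS; apply/and4P; split=> //; apply/eqP.
  have := top a b aS _ bS eab; have := top b a bS _ aS (esym eab).
  by rewrite !inE nbA naA => /(_ isT) ? /(_ isT) ?; lia.
by have := cardsID A S; have := subset_leq_card (subsetIr S A); lia.
Qed.

End Grid.

(** * The quadratic lower bound *)

Lemma ramsey_arrow_gt s m t n : 4 <= s -> 2 * m < t ->
  ramsey_arrow n (tight_path s) t -> m ^ 2 < n.
Proof.
move=> s4 ltmt arr; rewrite ltnNge; apply/negP=> len.
(* Quotient and remainder by [m] place the at most [m ^ 2] vertices injectively in the grid. *)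
pose u (i : 'I_n) := i %/ m; pose v (i : 'I_n) := i %% m.
have uv_inj a b : u a = u b -> v a = v b -> a = b.
  by move=> eu ev; apply/val_inj; rewrite /= (divn_eq a m) (divn_eq b m) -/(u a) -/(v a) eu ev.
(* If [m] is 0 there are no vertices, so positivity is drawn from a vertex. *)
have m_gt0 (i : 'I_n) : 0 < m.
  by have := ltn_ord i; case: (m) len => //; lia.
have ltu i : u i < m.
  by rewrite /u ltn_divLR ?(m_gt0 i) // mulnn (leq_trans (ltn_ord i)).
have ltv i : v i < m by rewrite /v ltn_mod (m_gt0 i).
case: (arr (corner_edge u v)) => -[f [injf fE]].
  (* Only the first six vertices of the path matter; [inord] is faithful on them since [4 <= s]. *)
  apply: (@corner_edge_tight_path_free _ u v uv_inj (fun i => f (inord i))).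
    move=> i j; rewrite !inE => lti ltj /injf/(congr1 val) /=.
    by rewrite !inordK; lia.
  move=> i lti; have lti' : i < s by lia.
  have := fE _ (imset_f (fun i : 'I_s => [set inord i; inord i.+1; inord i.+2])
    (isT : Ordinal lti' \in 'I_s)).
  by rewrite !imsetU !imset_set1 !inE => /andP[_ /eqP].
suff : #|f @: [set: 'I_t]| <= 2 * m.
  by rewrite card_imset // cardsT card_ord leqNgt ltmt.
apply: (card_corner_free uv_inj ltu ltv).
move=> _ _ _ /imsetP[i _ ->] /imsetP[j _ ->] /imsetP[k _ ->].
apply/negP=> cor; have := cor => /and4P[/eqP uij vij /eqP vik uik].
have nij : i != j by apply: contraTneq vij => ->; rewrite ltnn.
have nik : i != k by apply: contraTneq uik => ->; rewrite ltnn.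
have njk : j != k by apply: contraTneq uik => <-; rewrite uij ltnn.
have /fE : [set i; j; k] \in hedges (complete3 t).
  by rewrite inE setUC cardsU1 cards2 !inE nij (eq_sym k) (eq_sym k) negb_or nik njk.
rewrite !imsetU !imset_set1 inE => /andP[_ /eqP/negbT/negP[]].
by apply/existsP; exists (f i); apply/existsP; exists (f j);
  apply/existsP; exists (f k); rewrite cor eqxx.
Qed.

(** * Existence of the Ramsey number and the final constants *)

Lemma exists_ramsey_number F t n : ramsey_arrow n F t ->
  exists2 r, is_ramsey_number F t r & r <= n.
Proof.
move=> /asboolP arr.
have exP : exists r, `[< ramsey_arrow r F t >] by exists n.
case: (ex_minnP exP) => r /asboolP arr_r min_r.
exists r; last exact: min_r.
by split=> // m /asboolP; apply: min_r.
Qed.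

Local Open Scope ring_scope.

Theorem mainTheorem2 (R : realType) (s : nat) (hs : (4 <= s)%N) :
  exists c C : R, [/\ 0 < c, 0 < C &
    exists t0 : nat, forall t : nat, (t0 <= t)%N ->
      exists r : nat, is_ramsey_number (tight_path s) t r /\
        c * t%:R ^+ 2 <= r%:R <= C * t%:R ^+ 2].
Proof.
exists 16^-1, (32 * s.+2)%:R; split; first by rewrite invr_gt0 ltr0n.
  by rewrite ltr0n.
exists 4 => t t4.
have [|r ramr ler] := exists_ramsey_number (@ramsey_arrow_quadratic s t _).
  exact: leq_trans t4.
exists r; split=> //.
(* With [m = t.-1./2], [2 * m < t], and [t <= 4 * m] once [t >= 4]. Hence [t ^ 2 <= 16 * m ^ 2],
   which gives the constant 1/16. *)
have ltr : (t.-1./2 ^ 2 < r)%N.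
  by apply: (@ramsey_arrow_gt s _ t) ramr.1 => //; lia.
apply/andP; split; last by rewrite -natrX -natrM ler_nat.
rewrite ler_pdivrMl ?ltr0n // -natrX -natrM ler_nat.
have : (t <= 4 * t.-1./2)%N by lia.
by move: ltr; set m := t.-1./2; nia.
Qed.
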